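(* Under the assumptions stated in the context, the function $x_i^{\mathrm{cv}}$ is L-smooth at $\hat{\mathbf{p}}$, and for any $\mathbf{M}=[\mathbf{m}_{(1)}\;\cdots\;\mathbf{m}_{(r)}]\in\mathbb{R}^{n_p\times r}$, the sequence of functions \begin{equation*} \begin{aligned} &[x_i^{\mathrm{cv}}]^{(0)}_{\hat{\mathbf{p}},\mathbf{M}}:\mathbb{R}^{n_p}\to\mathbb{R}:\mathbf{d}\mapsto[x_i^{\mathrm{cv}}]'(\hat{\mathbf{p}};\mathbf{d}),\\ &[x_i^{\mathrm{cv}}]^{(j)}_{\hat{\mathbf{p}},\mathbf{M}}:\mathbb{R}^{n_p}\to\mathbb{R}:\mathbf{d}\mapsto\left[[x_i^{\mathrm{cv}}]^{(j-1)}_{\hat{\mathbf{p}},\mathbf{M}}\right]'(\mathbf{m}_{(j)};\mathbf{d}),\quad \forall j\in\{1,...,r\}, \end{aligned} \end{equation*} is well-defined and given by: for each $j\in\{0,...,r\}$, \begin{equation*} \begin{aligned} [x_i^{\mathrm{cv}}]^{(j)}_{\hat{\mathbf{p}},\mathbf{M}}(\mathbf{d})=\max_{\boldsymbol{\lambda}^{\mathrm{A}},\boldsymbol{\lambda}^{\mathrm{B}}}\quad&[\mathbf{G}\mathbf{d}]^\top\boldsymbol{\lambda}\\ \text{s.t.}\quad& \mathbf{A}^\top\boldsymbol{\lambda}^{\mathrm{A}} + \mathbf{B}^\top\boldsymbol{\lambda}^{\mathrm{B}} = \mathbf{e}^{(i)},\quad \boldsymbol{\lambda}^{\mathrm{A}}\le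 \mathbf{0},\\ &-[\mathbf{G}\mathbf{m}_{(q)}]^\top\boldsymbol{\lambda}\le -[x_i^{\mathrm{cv}}]_{\hat{\mathbf{p}},\mathbf{M}}^{(q-1)}(\mathbf{m}_{(q)}),\quad \forall q\in\{1,\dots,j\}, \end{aligned} \end{equation*} with $\boldsymbol{\lambda} := (\boldsymbol{\lambda}^{\mathrm{A}},\boldsymbol{\lambda}^{\mathrm{B}})$ and $\mathbf{G}:=\begin{bmatrix}\mathbf{G}^{\mathrm{A}}\\\mathbf{G}^{\mathrm{B}}\end{bmatrix}$ (for $j=0$ the last family of constraints is absent). Moreover, for each $j\in\{0,...,r-1\}$ let $D^{(j)}_{\hat{\mathbf{p}},\mathbf{M}}$ be the optimal solution set of the LP defining $[x_i^{\mathrm{cv}}]^{(j)}_{\hat{\mathbf{p}},\mathbf{M}}(\mathbf{m}_{(j+1)})$. Then for each $j\in\{1,...,r-1\}$, \begin{equation*} D^{(j)}_{\hat{\mathbf{p}},\mathbf{M}}\equiv\Big(\arg\max _{\boldsymbol{\lambda}\in D^{(j-1)}_{\hat{\mathbf{p}},\mathbf{M}}}[\mathbf{G}\mathbf{m}_{(j+1)}]^\top\boldsymbol{\lambda}\Big)\subset D^{(j-1)}_{\hat{\mathbf{p}},\mathbf{M}}, \end{equation*} and the LD-derivative of $x_i^{\mathrm{cv}}$ at $\hat{\mathbf{p}}$ in the directions $\mathbf{M}$ is \begin{equation*} [x_i^{\mathrm{cv}}]'(\hat{\mathbf{p}};\mathbf{M})\equiv\boldsymbol{\lambda}^\top\mathbf{G}\mathbf{M},\quad\text{for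 any }\boldsymbol{\lambda}\in D^{(r-1)}_{\hat{\mathbf{p}},\mathbf{M}}. \end{equation*}
   Context: Setting: a residual function $\mathbf{f}:\mathbb{R}^{n_x}\times\mathbb{R}^{n_p}\to\mathbb{R}^{n_x}$, a convex compact set $P\subset\mathbb{R}^{n_p}$, and $Q\subset P$ the (nonempty) set of $\mathbf{p}\in P$ for which $\mathbf{f}(\mathbf{z},\mathbf{p})=\mathbf{0}$ has a solution; an implicit function $\mathbf{x}:Q\to\mathbb{R}^{n_x}$ satisfies $\mathbf{f}(\mathbf{x}(\mathbf{p}),\mathbf{p})=\mathbf{0}$ with $\mathbf{x}(\mathbf{p})\in X:=[\mathbf{x}^{\mathrm{L}},\mathbf{x}^{\mathrm{U}}]$. Given convex/concave relaxations $\mathbf{f}^{\mathrm{cv}},\mathbf{f}^{\mathrm{cc}}$ of $\mathbf{f}$ on $X\times P$, $x_i^{\mathrm{cv}}(\mathbf{p}):=\inf_{\boldsymbol{\xi}\in X}\xi_i$ s.t. $\mathbf{f}^{\mathrm{cv}}(\boldsymbol{\xi},\mathbf{p})\le\mathbf{0}\le\mathbf{f}^{\mathrm{cc}}(\boldsymbol{\xi},\mathbf{p})$. Assume $\mathbf{f}\equiv(\tilde{\mathbf{f}},\mathbf{h})$ with $\mathbf{h}:\mathbb{R}^{n_x}\times\mathbb{R}^{n_p}\to\mathbb{R}^{n_h}$ affine and each $\tilde f_k$ non-affine, whose relaxations are pointwise max of continuously differentiable convex functions (for $\tilde f_k^{\mathrm{cv}}$) and pointwise min of continuously differentiable concave functions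 (for $\tilde f_k^{\mathrm{cc}}$); then $x_i^{\mathrm{cv}}(\mathbf{p})=\min_{\boldsymbol{\xi}\in\mathbb{R}^{n_x}}\xi_i$ s.t. $\mathbf{h}(\boldsymbol{\xi},\mathbf{p})=\mathbf{0}$, $\mathbf{g}(\boldsymbol{\xi},\mathbf{p})\le\mathbf{0}$, where $\mathbf{g}:\mathbb{R}^{n_x}\times\mathbb{R}^{n_p}\to\mathbb{R}^{n_g}$ collects all these smooth inequality constraints and the box constraint $\boldsymbol{\xi}\in X$. At $\hat{\mathbf{p}}\in\mathrm{int}(Q)$ assume the $\boldsymbol{\xi}$-gradients of the components of $\mathbf{h}$ are linearly independent and that a strong Slater condition holds on a neighborhood $N_{\hat{\mathbf{p}}}\subset Q$ (for each $\mathbf{p}\in N_{\hat{\mathbf{p}}}$ there is $\boldsymbol{\xi}_\mathbf{p}\in X$ with $\mathbf{h}(\boldsymbol{\xi}_\mathbf{p},\mathbf{p})=\mathbf{0}$, $\mathbf{g}(\boldsymbol{\xi}_\mathbf{p},\mathbf{p})<\mathbf{0}$). Let $\hat{\boldsymbol{\xi}}$ be any optimal solution of this problem at $\hat{\mathbf{p}}$. Then the directional derivative satisfies $[x_i^{\mathrm{cv}}]'(\hat{\mathbf{p}};\mathbf{d})=\min_{\mathbf{w}\in\mathbb{R}^{n_x}}[\mathbf{e}^{(i)}]^\top\mathbf{w}$ s.t. $\mathbf{A}\mathbf{w}\le\mathbf{G}^{\mathrm{A}}\mathbf{d}$, $\mathbf{B}\mathbf{w}=\mathbf{G}^{\mathrm{B}}\mathbf{d}$,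 where $\mathbf{A}\in\mathbb{R}^{n_A\times n_x}$ has rows $[\nabla_\mathbf{x}g_k(\hat{\boldsymbol{\xi}},\hat{\mathbf{p}})]^\top$ and $\mathbf{G}^{\mathrm{A}}\in\mathbb{R}^{n_A\times n_p}$ has rows $-[\nabla_\mathbf{y}g_k(\hat{\boldsymbol{\xi}},\hat{\mathbf{p}})]^\top$ over the active indices $k$ (those with $g_k(\hat{\boldsymbol{\xi}},\hat{\mathbf{p}})=0$), and $\mathbf{B}\in\mathbb{R}^{n_B\times n_x}$ has rows $[\nabla_\mathbf{x}h_j(\hat{\boldsymbol{\xi}},\hat{\mathbf{p}})]^\top$ and $\mathbf{G}^{\mathrm{B}}\in\mathbb{R}^{n_B\times n_p}$ has rows $-[\nabla_\mathbf{y}h_j(\hat{\boldsymbol{\xi}},\hat{\mathbf{p}})]^\top$ over the components of $\mathbf{h}$; $\nabla_\mathbf{x},\nabla_\mathbf{y}$ denote partial gradients with respect to $\boldsymbol{\xi}$ and $\mathbf{p}$. $\mathbf{e}^{(i)}$ is the $i$th unit coordinate vector. L-smoothness and the LD-derivative $[x_i^{\mathrm{cv}}]'(\hat{\mathbf{p}};\mathbf{M}):=[[x_i^{\mathrm{cv}}]^{(0)}_{\hat{\mathbf{p}},\mathbf{M}}(\mathbf{m}_{(1)})\;\cdots\;[x_i^{\mathrm{cv}}]^{(r-1)}_{\hat{\mathbf{p}},\mathbf{M}}(\mathbf{m}_{(r)})]$ are in the sense of Nesterov and Khan–Barton. *)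

(* Defs.v *)
From HB Require Import structures.
From mathcomp Require Import all_boot all_order all_algebra.
From mathcomp Require Import all_classical all_reals all_analysis.
Set Implicit Arguments. Unset Strict Implicit. Unset Printing Implicit Defensive.
Import Order.TTheory GRing.Theory Num.Theory.
Import numFieldNormedType.Exports.
Local Open Scope classical_set_scope.
Local Open Scope ring_scope.

Section Defs.
Variable R : realType.

Definition box {n} (lo hi : 'cV[R]_n) : set 'cV[R]_n :=
  [set z | forall k, lo k 0 <= z k 0 <= hi k 0].

Definition dotv {n} (u v : 'cV[R]_n) : R := \sum_k u k 0 * v k 0.

Definition is_affine {nx np} (F : 'cV[R]_nx -> 'cV[R]_np -> R) :=
  exists (a : 'cV[R]_nx) (b : 'cV[R]_np) (c : R),
    forall z p, F z p = dotv a z + dotv b p + c.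

Definition convex_on {nx np} (S : set ('cV[R]_nx * 'cV[R]_np))
    (F : 'cV[R]_nx -> 'cV[R]_np -> R) :=
  forall z1 p1 z2 p2 (t : R), S (z1, p1) -> S (z2, p2) -> 0 <= t <= 1 ->
    F ((1 - t) *: z1 + t *: z2) ((1 - t) *: p1 + t *: p2)
      <= (1 - t) * F z1 p1 + t * F z2 p2.

Definition concave_on {nx np} (S : set ('cV[R]_nx * 'cV[R]_np))
    (F : 'cV[R]_nx -> 'cV[R]_np -> R) :=
  convex_on S (fun z p => - F z p).

Definition joint {nx np} (F : 'cV[R]_nx -> 'cV[R]_np -> R) : 'cV[R]_(nx + np) -> R :=
  fun w => F (usubmx w) (dsubmx w).

Definition C1 {nx np} (F : 'cV[R]_nx -> 'cV[R]_np -> R) :=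
  (forall w, differentiable (joint F) w) /\
  (forall v, continuous (fun w => 'd (joint F) w v)).

Definition gradx {nx np} (F : 'cV[R]_nx -> 'cV[R]_np -> R) z p : 'cV[R]_nx :=
  \col_k 'D_(delta_mx k 0) (fun z' => F z' p) z.
Definition grady {nx np} (F : 'cV[R]_nx -> 'cV[R]_np -> R) z p : 'cV[R]_np :=
  \col_k 'D_(delta_mx k 0) (fun p' => F z p') p.

Definition fam_max {m} (F : 'I_m.+1 -> R) : R := \big[Num.max/F ord0]_(l < m.+1) F l.
Definition fam_min {m} (F : 'I_m.+1 -> R) : R := \big[Num.min/F ord0]_(l < m.+1) F l.

Definition gidx nf (ncv ncc : 'I_nf -> nat) nx : finType :=
  (({k : 'I_nf & 'I_(ncv k).+1} + {k : 'I_nf & 'I_(ncc k).+1}) + ('I_nx + 'I_nx))%type.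

(* g collects: phi_{k,l} <= 0 (convex relaxation pieces), - psi_{k,l} <= 0
   (concave relaxation pieces), and the box constraints xi <= xU, xL <= xi *)
Definition gfun {nx np nf} {ncv ncc : 'I_nf -> nat}
    (phi : forall k, 'I_(ncv k).+1 -> 'cV[R]_nx -> 'cV[R]_np -> R)
    (psi : forall k, 'I_(ncc k).+1 -> 'cV[R]_nx -> 'cV[R]_np -> R)
    (xL xU : 'cV[R]_nx) (c : gidx ncv ncc nx) : 'cV[R]_nx -> 'cV[R]_np -> R :=
  match c with
  | inl (inl (existT k l)) => phi k l
  | inl (inr (existT k l)) => fun z p => - psi k l z p
  | inr (inl j) => fun z p => z j 0 - xU j 0
  | inr (inr j) => fun z p => xL j 0 - z j 0
  end.

Definition dquot {n} (f : 'cV[R]_n -> R) (x d : 'cV[R]_n) : R -> R :=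
  fun t => (f (x + t *: d) - f x) / t.
Definition has_dirder {n} (f : 'cV[R]_n -> R) x d := cvg (dquot f x d @ 0^'+).
Definition dirder {n} (f : 'cV[R]_n -> R) x d : R := lim (dquot f x d @ 0^'+).

Fixpoint lexfun {n} (f : 'cV[R]_n -> R) (x : 'cV[R]_n) (ms : seq 'cV[R]_n) (j : nat)
  : 'cV[R]_n -> R :=
  match j with
  | 0 => dirder f x
  | j'.+1 => dirder (lexfun f x ms j') (nth 0 ms j')
  end.

Definition lex_wd {n} (f : 'cV[R]_n -> R) x (ms : seq 'cV[R]_n) :=
  (forall d, has_dirder f x d) /\
  (forall j, (j < size ms)%N -> forall d, has_dirder (lexfun f x ms j) (nth 0 ms j) d).

Definition cols {n r} (M : 'M[R]_(n, r)) : seq 'cV[R]_n := [seq col j M | j <- enum 'I_r].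

Definition loc_lipschitz {n} (f : 'cV[R]_n -> R) (x : 'cV[R]_n) :=
  exists U, nbhs x U /\ exists L : R,
    forall y z, U y -> U z -> `|f y - f z| <= L * `|y - z|.

Definition Lsmooth {n} (f : 'cV[R]_n -> R) x :=
  loc_lipschitz f x /\ forall r (M : 'M[R]_(n, r)), lex_wd f x (cols M).

Definition LDder {n r} (f : 'cV[R]_n -> R) x (M : 'M[R]_(n, r)) : 'rV[R]_r :=
  \row_(j < r) lexfun f x (cols M) j (col j M).

Definition is_maximum {T} (S : set T) (obj : T -> R) (v : R) :=
  (exists l, S l /\ obj l = v) /\ forall l, S l -> obj l <= v.

Definition argmax_set {T} (S : set T) (obj : T -> R) : set T :=
  [set l | S l /\ forall m, S m -> obj m <= obj l].

End Defs.

(* Main.v *)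
Require Import Defs.
From HB Require Import structures.
From mathcomp Require Import all_boot all_order all_algebra.
From mathcomp Require Import all_classical all_reals all_analysis.
From mathcomp Require Import ring lra.
Import Order.TTheory GRing.Theory Num.Theory.
Import numFieldNormedType.Exports.
Local Open Scope classical_set_scope.
Local Open Scope ring_scope.

(* The difference quotient of [xcv] at [phat] along [d] converges to the maximum of
   [G d . lam] over the set [Lam 0] of Lagrange multipliers: every multiplier gives a
   lower bound, because the gradient inequality for the jointly convex constraints
   linearizes the feasible sets; conversely, by a theorem of the alternative, any number
   above the maximum is the slope of a ray that stays strictly inside the linearized
   active constraints, hence feasible for small steps.  The Slater point and the
   independence of the equality gradients make [Lam 0] compact.  From there on only
   Danskin's formula is needed: the directional derivative at [m] of the support
   function of a compact set is the support function of the face exposed by [m], and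
   [Lam j.+1] is the face of [Lam j] exposed by the next column of [M].
   Local Lipschitz continuity follows from convexity and boundedness near [phat]. *)

Set Implicit Arguments.
Unset Strict Implicit.

(** * Maxima over compact sets *)

Lemma trmx_continuous (K : numFieldType) m n :
  continuous (trmx : 'M[K]_(m, n) -> 'M[K]_(n, m)).
Proof.
move=> M s /= /(nbhs_ballP M^T) [e e0 es].
apply/nbhs_ballP; exists e => //= N [_ MN]; apply: es; split => // i j.
by rewrite !mxE; exact: MN.
Qed.

Lemma mulmx_coord_continuous (R : realType) m n (C : 'M[R]_(m, n)) j :
  continuous (fun x : 'cV[R]_n => (C *m x) j 0).
Proof.
have -> : (fun x : 'cV[R]_n => (C *m x) j 0) = (fun x => \sum_k C j k * x k 0).
  by apply/funext => x; rewrite mxE.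
apply: continuous_big => [|k _]; first exact: add_continuous.
move=> x; apply: (@continuousM R 'cV[R]_n (fun=> C j k) (fun x => x k 0)).
  exact: cst_continuous.
exact: coord_continuous.
Qed.

(** Heine-Borel, carried from row vectors to column vectors by the continuity of transposition. *)
Lemma bounded_closed_compact_cV (R : realType) n (S : set 'cV[R]_n) :
  (exists b, forall x, S x -> forall k, `|x k 0| <= b) -> closed S -> compact S.
Proof.
move=> [b Sb] clS.
have -> : S = trmx @` (trmx @^-1` S).
  rewrite eqEsubset; split => [x Sx|_ [x Sx <-]//].
  by exists x^T; rewrite /= ?trmxK.
apply: continuous_compact.
  by apply: continuous_subspaceT; exact: trmx_continuous.
apply: bounded_closed_compact; last first.
  by move/continuous_closedP : (@trmx_continuous R 1 n); exact.
exists `|b|; split => [|B bB x Sx]; first exact: num_real.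
rewrite /Num.norm /= mx_normrE; apply/bigmax_leP; split => [|[i j] _ /=].
  by apply: le_trans (ltW bB).
have := Sb _ Sx j; rewrite mxE ord1 => /le_trans; apply.
by apply: le_trans (ltW bB); exact: ler_norm.
Qed.

Lemma compact_maximum (R : realType) (T : topologicalType) (L : set T) (f : T -> R) :
  compact L -> L !=set0 -> continuous f -> exists v, is_maximum L f v.
Proof.
move=> cL L0 cf.
have [|c cL' cmax] := @compact_EVT_max T R f L L0 cL.
  exact: continuous_subspaceT.
exists (f c); split; first by exists c; split => //; exact: set_mem.
by move=> l Ll; apply: cmax; exact: mem_set.
Qed.

Lemma closed_fun_ge (R : realType) (T : topologicalType) (f : T -> R) c :
  continuous f -> closed [set x | c <= f x].
Proof.
move=> /continuous_closedP cf; apply: (cf [set x | c <= x]); exact: closed_ge.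
Qed.

Lemma closed_fun_eq (R : realType) (T : topologicalType) (f : T -> R) c :
  continuous f -> closed [set x | f x = c].
Proof.
move=> /continuous_closedP cf; apply: (cf [set x | x = c]); exact: closed_eq.
Qed.

Lemma compact_superlevel (R : realType) (T : topologicalType) (L : set T)
    (f : T -> R) c :
  compact L -> continuous f -> compact [set l | L l /\ c <= f l].
Proof.
move=> cL cf.
apply: (compact_closedI cL); exact: closed_fun_ge.
Qed.

(* Points of [L] where [b] exceeds its maximum [v] on the face by [e] form a
   compact set off the face, so [a] stays a fixed amount below [s 0] there. *)
Lemma danskin (R : realType) (T : topologicalType) (L : set T) (a b : T -> R)
    (s : R -> R) (v : R) :
  compact L -> continuous a -> continuous b ->
  (forall t, 0 <= t -> is_maximum L (fun l => a l + t * b l) (s t)) ->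
  is_maximum [set l | L l /\ s 0 <= a l] b v ->
  (s t - s 0) / t @[t --> 0^'+] --> v.
Proof.
move=> cL ca cb smax [[l0 [[Ll0 al0] <-]] bmax].
have amax l : L l -> a l <= s 0.
  by move=> /((smax 0 (lexx 0)).2); rewrite mul0r addr0.
have {}al0 : a l0 = s 0 by apply/le_anti; rewrite al0 amax.
(* The face point [l0] satisfies [a l0 = s 0], so it competes in the maximum [s t] with value
   [s 0 + t * b l0]. *)
have lb t : 0 < t -> b l0 <= (s t - s 0) / t.
  move=> t0; rewrite ler_pdivlMr // lerBrDl mulrC -al0.
  exact: (smax t (ltW t0)).2.
suff ub e : 0 < e -> \forall t \near 0^'+, (s t - s 0) / t <= b l0 + e.
  apply/cvgrPdist_le => e e0; near=> t.
  have t0 : 0 < t by near: t; exact: nbhs_right_gt.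
  rewrite ler0_norm ?subr_le0 ?lb // opprB lerBlDl.
  by near: t; exact: ub.
move=> e0.
pose K := [set l | L l /\ b l0 + e <= b l].
have [K0|/set0P/negP/negPn/eqP K0] := pselect (K !=set0); last first.
  near=> t; have t0 : 0 < t by near: t; exact: nbhs_right_gt.
  have [[l [Ll <-]] _] := smax t (ltW t0).
  have : ~ K l by rewrite K0.
  move=> /not_andP[//|/negP]; rewrite -ltNge => bl.
  rewrite ler_pdivrMr // lerBlDl lerD ?amax // mulrC ler_wpM2r //; exact: ltW.
have cK : compact K by exact: compact_superlevel.
have [A [[kA [[LkA bkA] eA]] Amax]] := compact_maximum cK K0 ca.
have [B [_ Bmax]] := compact_maximum cK K0 cb.
have As : A < s 0.
  rewrite -eA lt_neqAle amax // andbT; apply/eqP => akA.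
  have : b kA <= b l0 by apply: bmax; split; rewrite ?akA.
  by move=> /(le_trans bkA); rewrite gerDl leNgt e0.
pose C := B - (b l0 + e).
have C0 : 0 <= C.
  by rewrite subr_ge0; apply: le_trans bkA (Bmax _ (conj LkA bkA)).
near=> t; have t0 : 0 < t by near: t; exact: nbhs_right_gt.
have [[l [Ll <-]] _] := smax t (ltW t0).
rewrite ler_pdivrMr // lerBlDl.
have [Kl|/not_andP[//|/negP]] := pselect (K l); last first.
  rewrite -ltNge => bl.
  by rewrite lerD ?amax // mulrC ler_wpM2r //; exact: ltW.
have aA := Amax _ Kl; have bB := Bmax _ Kl.
(* On [K] the gain from [b] beyond slope [b l0 + e] is at most [t * C], which small [t] keeps below
   the gap [s 0 - A]; the added 1 keeps the divisor positive. *)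
have tC : t * (C + 1) <= s 0 - A.
  rewrite -ler_pdivlMr; last by rewrite ltr_wpDl.
  near: t; apply: nbhs_right_le; rewrite divr_gt0 ?subr_gt0 //.
  by rewrite ltr_wpDl.
have : t * b l <= t * B by rewrite ler_wpM2l // ltW.
move: tC; rewrite /C; nra.
Unshelve. all: by end_near. Qed.

Lemma dirder_cvg (R : realType) n (f : 'cV[R]_n -> R) x d (v : R) :
  dquot f x d t @[t --> 0^'+] --> v -> has_dirder f x d /\ dirder f x d = v.
Proof.
move=> fv; split; first by apply/cvg_ex; exists v.
exact: cvg_lim.
Qed.

(** * Lexicographic derivatives as support functions of successive faces *)

Section LexicographicFaces.
Variables (R : realType) (n : nat) (T : topologicalType) (L : set T).
Variables (obj : 'cV[R]_n -> T -> R) (f : 'cV[R]_n -> R) (x : 'cV[R]_n).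
Variable ms : seq 'cV[R]_n.
Hypothesis compactL : compact L.
Hypothesis L_neq0 : L !=set0.
Hypothesis obj_continuous : forall d, continuous (obj d).
Hypothesis objDZ : forall d e t l, obj (d + t *: e) l = obj d l + t * obj e l.
Hypothesis dquot_f :
  forall d v, is_maximum L (obj d) v -> dquot f x d t @[t --> 0^'+] --> v.

(** Abstract form of the feasible set of the [j]-th LP, over a base set [L]. Past the end of [ms]
    the direction is the default 0, so every stage [j] makes sense. *)
Definition lexface j : set T :=
  [set l | L l /\ forall q, (q < j)%N ->
     lexfun f x ms q (nth 0 ms q) <= obj (nth 0 ms q) l].

Let F := lexfun f x ms.
Let m := nth 0 ms.

Lemma lexfaceS j : lexface j.+1 = [set l | lexface j l /\ F j (m j) <= obj (m j) l].
Proof.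
apply/seteqP; split=> l /=.
  move=> [Ll Hl]; split; last exact: Hl.
  by split=> // q qj; apply: Hl; exact: ltnW.
move=> [[Ll Hl] Hj]; split=> // q; rewrite ltnS leq_eqVlt => /orP[/eqP->//|].
exact: Hl.
Qed.

(** Danskin's formula on [lexface j] with [a := obj (m j)] and [b := obj d]: the face exposed by [a]
    is [lexface j.+1]. *)
Lemma lexface_dquot j d v :
  compact (lexface j) -> (forall e, is_maximum (lexface j) (obj e) (F j e)) ->
  is_maximum (lexface j.+1) (obj d) v ->
  dquot (F j) (m j) d t @[t --> 0^'+] --> v.
Proof.
move=> cj maxj maxd.
have -> : dquot (F j) (m j) d =
    (fun t => (F j (m j + t *: d) - F j (m j + 0 *: d)) / t).
  by apply/funext => t; rewrite /dquot scale0r addr0.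
apply: (danskin (s := fun t => F j (m j + t *: d)) cj (obj_continuous (d := m j))
  (obj_continuous (d := d))).
  move=> t _; rewrite (_ : (fun l => _) = obj (m j + t *: d)) //.
  by apply/funext => l; rewrite objDZ.
by rewrite scale0r addr0 -lexfaceS.
Qed.

(** Compactness and the maximum formula go through one induction: the formula at stage [j] makes the
    next face nonempty, and compactness of that face gives a maximum, which Danskin's formula
    identifies with the next derivative. *)
Lemma lexface_maximum j :
  compact (lexface j) /\ forall d, is_maximum (lexface j) (obj d) (F j d).
Proof.
elim: j => [|j [cj maxj]].
  have -> : lexface 0 = L by apply/seteqP; split=> l //= [].
  split=> // d; have [v maxv] := compact_maximum compactL L_neq0 (obj_continuous (d := d)).
  by rewrite /F /= (dirder_cvg (dquot_f maxv)).2.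
have cSj : compact (lexface j.+1).
  by rewrite lexfaceS; apply: compact_superlevel.
split=> // d.
have Sj0 : lexface j.+1 !=set0.
  by have [[l [Hl El]] _] := maxj (m j); exists l; rewrite lexfaceS /= El.
have [v maxv] := compact_maximum cSj Sj0 (obj_continuous (d := d)).
by rewrite /F /= (dirder_cvg (lexface_dquot cj maxj maxv)).2.
Qed.

Lemma lexface_wd : lex_wd f x ms.
Proof.
split=> [d|j _ d].
  have [v maxv] := compact_maximum compactL L_neq0 (obj_continuous (d := d)).
  exact: (dirder_cvg (dquot_f maxv)).1.
have [cj maxj] := lexface_maximum j.
exact: (dirder_cvg (lexface_dquot cj maxj ((lexface_maximum j.+1).2 d))).1.
Qed.

(** Since [F j (m j)] is the maximum of [obj (m j)] on [lexface j], the inequality added at stage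
    [j.+1] selects exactly the maximizers. *)
Lemma argmax_lexface j : argmax_set (lexface j) (obj (m j)) = lexface j.+1.
Proof.
have [_ /(_ (m j)) [[l0 [Hl0 E0]] maxj]] := lexface_maximum j.
rewrite lexfaceS; apply/seteqP; split=> l /= [Hl Hm]; split=> //.
  by rewrite -E0; exact: Hm.
by move=> k /maxj kF; exact: le_trans kF Hm.
Qed.

(** The constraints defining a face are tight: [F q (m q)] also bounds [obj (m q)] from above on the
    larger set [lexface q]. *)
Lemma lexface_obj j q l : (q < j)%N -> lexface j l -> obj (m q) l = F q (m q).
Proof.
move=> qj [Ll Hl]; apply/le_anti; rewrite Hl // andbT.
apply: ((lexface_maximum q).2 (m q)).2; split=> // k kq.
by apply: Hl; exact: ltn_trans kq qj.
Qed.

End LexicographicFaces.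

(** * Linear programming duality *)

(* A point of minimal norm [z] in the convex hull of the rows of [A] satisfies
   [a . z >= |z|^2] for every row [a]; hence [- z] works unless [z = 0]. *)
Lemma gordan (R : realType) m n (A : 'M[R]_(m, n)) :
  (exists u : 'cV[R]_n, forall k, (A *m u) k 0 < 0) \/
  (exists y : 'cV[R]_m, [/\ forall k, 0 <= y k 0, \sum_k y k 0 = 1 & A^T *m y = 0]).
Proof.
(* Without rows the simplex is empty, while the first alternative holds vacuously. *)
case: m A => [|m] A; first by left; exists 0 => -[].
pose S := [set y : 'cV[R]_m.+1 | (forall k, 0 <= y k 0) /\ \sum_k y k 0 = 1].
pose q (y : 'cV[R]_m.+1) := \sum_j (A^T *m y) j 0 ^+ 2.
have cq : continuous q.
  apply: continuous_big => [|j _]; first exact: add_continuous.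
  move=> y; apply: (@continuousM R 'cV[R]_m.+1 (fun y => (A^T *m y) j 0) (fun y => (A^T *m y) j 0));
    exact: mulmx_coord_continuous.
have S1 k : S (delta_mx k 0).
  split=> [j|]; first by rewrite mxE ler0n.
  rewrite (bigD1 k) //= mxE !eqxx big1 ?addr0 // => j jk.
  by rewrite mxE (negbTE jk).
have cS : compact S.
  apply: bounded_closed_compact_cV.
    exists 1 => y [y0 y1] k; rewrite ger0_norm // -y1 (bigD1 k) //= lerDl.
    exact: sumr_ge0.
  have -> : S = \bigcap_k [set y | 0 <= y k 0] `&` [set y | \sum_k y k 0 = 1].
    by apply/seteqP; split=> y [y0 y1]; split=> // k; [move=> _|]; exact: y0.
  apply: closedI.
    apply: closed_bigI => k _.
    by apply: closed_fun_ge; exact: coord_continuous.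
  apply: closed_fun_eq.
  apply: continuous_big => [|k _]; first exact: add_continuous.
  exact: coord_continuous.
have S0 : S !=set0 by exists (delta_mx 0 0).
have [|y /set_mem[y0 y1] ymin] := @compact_EVT_min _ R q S S0 cS.
  exact: continuous_subspaceT.
have [yA|yA] := eqVneq (A^T *m y) 0; first by right; exists y.
left; exists (- (A^T *m y)) => k; set z := A^T *m y.
have zz : 0 < \sum_j z j 0 ^+ 2.
  rewrite lt_neqAle sumr_ge0 ?andbT; last by move=> j _; exact: sqr_ge0.
  apply: contra yA; rewrite eq_sym => /eqP/psumr_eq0P zj.
  apply/eqP/colP => j; rewrite [RHS]mxE; apply/eqP.
  by rewrite -sqrf_eq0 zj // => ? _; exact: sqr_ge0.
suff : \sum_j z j 0 ^+ 2 <= \sum_j A k j * z j 0.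
  rewrite mulmxN mxE mxE oppr_lt0; exact: lt_le_trans.
pose b : 'cV[R]_n := \col_j A k j - z.
have bE j : b j 0 = A k j - z j 0.
  by rewrite [LHS]mxE [X in X + _]mxE [X in _ + X]mxE.
pose c1 := \sum_j z j 0 * b j 0; pose c2 := \sum_j b j 0 ^+ 2.
(* Minimality of [y] along the segment towards the vertex [delta_mx k 0]: the right side is the
   increment of [q] there, as [A^T] moves [z] to [z + t *: b]. *)
have key t : 0 <= t <= 1 -> 0 <= t * (c1 *+ 2 + t * c2).
  move=> /andP[t0 t1].
  have St : S ((1 - t) *: y + t *: delta_mx k 0).
    have [d0 d1] := S1 k; split=> [j|].
      by rewrite !mxE addr_ge0 // mulr_ge0 ?subr_ge0 // ler0n.
    under eq_bigr do rewrite mxE [X in X + _]mxE [X in _ + X]mxE.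
    by rewrite big_split /= -!mulr_sumr y1 d1 !mulr1 subrK.
  have := ymin _ (mem_set St); rewrite /q mulmxDr -!scalemxAr -/z.
  have -> : A^T *m delta_mx k 0 = b + z.
    rewrite subrK; apply/colP => j; rewrite !mxE (bigD1 k) //= !mxE !eqxx mulr1.
    by rewrite big1 ?addr0 // => l lk; rewrite !mxE (negbTE lk) mulr0.
  have -> : (1 - t) *: z + t *: (b + z) = z + t *: b.
    by apply/colP => j; rewrite !mxE; ring.
  rewrite -subr_ge0 -sumrB /c1 /c2.
  suff -> : \sum_(i < n) ((z + t *: b) i 0 ^+ 2 - z i 0 ^+ 2) =
      t * ((\sum_j z j 0 * b j 0) *+ 2 + t * \sum_j b j 0 ^+ 2) by [].
  rewrite -mulr_natr mulr_suml mulr_sumr -big_split /= mulr_sumr.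
  by apply: eq_bigr => j _; rewrite !mxE; ring.
have c1_ge0 : 0 <= c1.
  rewrite leNgt; apply/negP => c1n.
  have c2_ge0 : 0 <= c2 by apply: sumr_ge0 => j _; exact: sqr_ge0.
  (* With this [t] one has [t * c2 = t * c1 - c1], so the bracket in [key] becomes [c1 + t * c1],
     which is negative; the denominator is positive even when [c2] vanishes. *)
  pose t := - c1 / (c2 - c1).
  have d0 : 0 < c2 - c1 by rewrite subr_gt0 (lt_le_trans c1n).
  have t0 : 0 < t by rewrite divr_gt0 // oppr_gt0.
  have : 0 <= t <= 1.
    by rewrite ltW //= ler_pdivrMr // mul1r lerDr.
  move=> /key; rewrite pmulr_rge0 //.
  have td : t * (c2 - c1) = - c1 by rewrite divfK // gt_eqF.
  have : t * c1 <= 0 by rewrite pmulr_rle0 // ltW.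
  by move: td; lra.
rewrite -subr_ge0 -sumrB; suff <- : c1 = \sum_i (A k i * z i 0 - z i 0 ^+ 2) by [].
by apply: eq_bigr => j _; rewrite bE; ring.
Qed.

(** Gordan's alternative restricted to the kernel of [B], parametrized by [cokermx B]. A row
    annihilated by [cokermx B] lies in the row space of [B], which supplies [u]. *)
Lemma motzkin (R : realType) m n p (A : 'M[R]_(m, n)) (B : 'M[R]_(p, n)) :
  (exists w : 'cV[R]_n, B *m w = 0 /\ forall k, (A *m w) k 0 < 0) \/
  (exists (y : 'cV[R]_m) (u : 'cV[R]_p),
     [/\ forall k, 0 <= y k 0, \sum_k y k 0 = 1 & A^T *m y + B^T *m u = 0]).
Proof.
have [[u Au]|[y [y0 y1 Ay]]] := gordan (A *m cokermx B).
  left; exists (cokermx B *m u); split; last by move=> k; rewrite mulmxA.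
  by rewrite mulmxA mulmx_coker mul0mx.
right; have /submxP[v yv] : (y^T *m A <= B)%MS.
  by rewrite submxE -mulmxA -trmx_eq0 trmx_mul trmxK Ay.
exists y, (- v)^T; split=> //.
by apply: trmx_inj; rewrite linearD /= !trmx_mul !trmxK yv mulNmx subrr trmx0.
Qed.

Lemma tr_mulmxE (R : realType) n (u v : 'cV[R]_n) : (u^T *m v) 0 0 = \sum_k u k 0 * v k 0.
Proof. by rewrite mxE; apply: eq_bigr => k _; rewrite mxE. Qed.

Lemma tr_mulmxC (R : realType) n (u v : 'cV[R]_n) : (u^T *m v) 0 0 = (v^T *m u) 0 0.
Proof. by rewrite !tr_mulmxE; apply: eq_bigr => k _; rewrite mulrC. Qed.

Lemma mulmx_bounded (R : realType) m n (M : 'M[R]_(m, n)) b :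
  exists b', forall x : 'cV[R]_n, (forall k, `|x k 0| <= b) ->
    forall j, `|(M *m x) j 0| <= b'.
Proof.
exists (\sum_j \sum_k `|M j k| * b) => x xb j.
have b0 k : 0 <= `|M j k| * b by rewrite mulr_ge0 // (le_trans _ (xb k)).
rewrite (bigD1 j) //=; apply: ler_wpDr.
  apply: sumr_ge0 => i _; apply: sumr_ge0 => k _.
  by rewrite mulr_ge0 // (le_trans _ (xb k)).
rewrite mxE; apply: le_trans (ler_norm_sum _ _ _) _; apply: ler_sum => k _.
by rewrite normrM ler_wpM2l.
Qed.

(** * The multiplier polyhedron: weak duality, alternative, compactness *)

Section DualFace.
Variables (R : realType) (nA nB nx np : nat).
Variables (A : 'M[R]_(nA, nx)) (B : 'M[R]_(nB, nx)).
Variables (GA : 'M[R]_(nA, np)) (GB : 'M[R]_(nB, np)) (c : 'cV[R]_nx).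

Definition dual_feasible : set 'cV[R]_(nA + nB) :=
  [set lam | A^T *m usubmx lam + B^T *m dsubmx lam = c /\
             forall a, usubmx lam a 0 <= 0].

Definition dual_obj (d : 'cV[R]_np) (lam : 'cV[R]_(nA + nB)) : R :=
  ((col_mx GA GB *m d)^T *m lam) 0 0.

Lemma dual_objE d lam :
  dual_obj d lam =
  ((GA *m d)^T *m usubmx lam) 0 0 + ((GB *m d)^T *m dsubmx lam) 0 0.
Proof.
by rewrite /dual_obj mul_col_mx tr_col_mx -{1}[lam]vsubmxK mul_row_col mxE.
Qed.

Lemma dual_obj_continuous d : continuous (dual_obj d).
Proof. exact: mulmx_coord_continuous. Qed.

Lemma dual_objDZ d e t lam : dual_obj (d + t *: e) lam = dual_obj d lam + t * dual_obj e lam.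
Proof.
by rewrite /dual_obj mulmxDr -scalemxAr linearD linearZ /= mulmxDl -scalemxAl !mxE.
Qed.

Lemma dual_feasible_dot lam (w : 'cV[R]_nx) : dual_feasible lam ->
  (c^T *m w) 0 0 =
  ((usubmx lam)^T *m (A *m w)) 0 0 + ((dsubmx lam)^T *m (B *m w)) 0 0.
Proof.
move=> [<- _].
by rewrite linearD /= !trmx_mul !trmxK mulmxDl !mulmxA mxE.
Qed.

Lemma weak_duality lam (w : 'cV[R]_nx) d : dual_feasible lam ->
  (forall a, (A *m w) a 0 <= (GA *m d) a 0) -> B *m w = GB *m d ->
  dual_obj d lam <= (c^T *m w) 0 0.
Proof.
move=> Hlam Aw Bw; rewrite (dual_feasible_dot w Hlam) Bw dual_objE.
rewrite [X in _ <= _ + X]tr_mulmxC lerD2r !tr_mulmxE; apply: ler_sum => a _.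
by rewrite mulrC ler_wnM2l //; exact: Hlam.2.
Qed.

Variable slater : 'cV[R]_nx.
Hypothesis slaterA : forall a, (A *m slater) a 0 < 0.
Hypothesis slaterB : B *m slater = 0.
Hypothesis freeB : row_free B.

(** Pairing with the Slater direction removes the equality multipliers and leaves one strictly
    negative coefficient per inequality multiplier. *)
Lemma slater_dot (y : 'cV[R]_nA) (u : 'cV[R]_nB) :
  ((A^T *m y + B^T *m u)^T *m slater) 0 0 = \sum_a y a 0 * (A *m slater) a 0.
Proof.
rewrite linearD /= !trmx_mul !trmxK mulmxDl -!mulmxA slaterB mulmx0 addr0.
exact: tr_mulmxE.
Qed.

(** Homogenize the strict system with a positive scale variable and apply Motzkin's alternative. A
    solution is divided by its scale; a certificate is divided by the multiplier of the objective
    row, which the Slater direction and the independence of the rows of [B] keep nonzero. *)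
Lemma lp_alternative d s :
  (exists2 lam, dual_feasible lam & s <= dual_obj d lam) \/
  (exists w : 'cV[R]_nx, [/\ forall a, (A *m w) a 0 < (GA *m d) a 0, B *m w = GB *m d &
                 (c^T *m w) 0 0 < s]).
Proof.
(* The last column carries the scale [t]. The row blocks say [A w < t GA d], [c . w < t s] and
   [0 < t]; [B1] says [B w = t GB d]. *)
pose A1 : 'M[R]_(nA + (1 + 1), nx + 1) :=
  col_mx (row_mx A (- (GA *m d)))
         (col_mx (row_mx c^T (- s%:M)) (row_mx 0 (- 1%:M))).
pose B1 : 'M[R]_(nB, nx + 1) := row_mx B (- (GB *m d)).
have [[w [Bw Aw]]|[y [u [y0 y1 Ey]]]] := motzkin A1 B1.
  right; move: Bw Aw; rewrite -[w]vsubmxK.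
  set w1 := usubmx w; set t := dsubmx w => Bw Aw.
  have AwE : A1 *m col_mx w1 t = col_mx (A *m w1 - GA *m d *m t)
      (col_mx (c^T *m w1 - s%:M *m t) (- t)).
    by rewrite !mul_col_mx !mul_row_col mul0mx add0r !mulNmx mul1mx.
  have t0 : 0 < t 0 0.
    have := Aw (rshift _ (rshift _ 0)); rewrite AwE !col_mxEd mxE.
    by rewrite oppr_lt0.
  have tE : t = (t 0 0)%:M by rewrite -mx11_scalar.
  move: t0 tE; set t' := t 0 0 => t0 tE.
  exists (t'^-1 *: w1); split.
  - move=> a; have := Aw (lshift _ a); rewrite AwE col_mxEu tE mul_mx_scalar.
    rewrite -scalemxAr !mxE subr_lt0 => Hlt.
    by rewrite mulrC ltr_pdivrMr // mulrC.
  - move: Bw; rewrite mul_row_col mulNmx => /eqP; rewrite subr_eq0 => /eqP.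
    by rewrite -scalemxAr => ->; rewrite tE mul_mx_scalar scalerA mulVf ?scale1r ?gt_eqF.
  - have := Aw (rshift _ (lshift _ 0)); rewrite AwE col_mxEd col_mxEu tE.
    rewrite mul_scalar_mx -scalemxAr !mxE subr_lt0 mulr1n => Hlt.
    by rewrite mulrC ltr_pdivrMr.
left; move: y0 y1 Ey; rewrite -[y]vsubmxK -[dsubmx y]vsubmxK.
set y2 := usubmx y; set l0 := usubmx (dsubmx y); set l1 := dsubmx (dsubmx y).
move=> y0 y1 Ey.
have y2_ge0 a : 0 <= y2 a 0 by have := y0 (lshift _ a); rewrite col_mxEu.
have l0_ge0 : 0 <= l0 0 0.
  by have := y0 (rshift _ (lshift _ 0)); rewrite col_mxEd col_mxEu.
have l1_ge0 : 0 <= l1 0 0.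
  by have := y0 (rshift _ (rshift _ 0)); rewrite !col_mxEd.
move: Ey; rewrite !tr_col_mx !mul_row_col !tr_row_mx !mul_col_mx !add_col_mx.
rewrite -col_mx0 => /eq_col_mx[]; rewrite !linear0 mul0mx addr0 trmxK.
rewrite !linearN /= !mulNmx !tr_scalar_mx mul1mx mul_scalar_mx.
rewrite [l0]mx11_scalar [l1]mx11_scalar mul_mx_scalar.
set a0 := l0 0 0; set a1 := l1 0 0 => E1 E2.
have {}E2 : ((GA *m d)^T *m y2) 0 0 + ((GB *m d)^T *m u) 0 0 = - (a0 * s + a1).
  move/matrixP/(_ 0 0): E2; rewrite !mxE !mulr1n; lra.
(* If the objective multiplier vanished, the Slater direction would force [y2 = 0], independence
   [u = 0], and then [a1 = 0], against the total weight 1. *)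
have [l00|l0n0] := eqVneq a0 0.
  exfalso; rewrite l00 scale0r addr0 in E1.
  have y2_0 : y2 = 0.
    have : \sum_a y2 a 0 * (- (A *m slater) a 0) = 0.
      under eq_bigr do rewrite mulrN.
      by rewrite sumrN -(slater_dot y2 u) E1 trmx0 mul0mx mxE oppr0.
    move=> /psumr_eq0P yA; apply/colP => a; rewrite [RHS]mxE.
    have /eqP : y2 a 0 * (- (A *m slater) a 0) = 0.
      by apply: yA => // b _; rewrite mulr_ge0 ?oppr_ge0 // ltW.
    by rewrite mulf_eq0 oppr_eq0 (lt_eqF (slaterA a)) orbF => /eqP.
  have u0 : u = 0.
    apply: trmx_inj; apply: (row_free_inj freeB).
    rewrite /= trmx0 mul0mx -[B]trmxK -trmx_mul.
    by move: E1; rewrite y2_0 mulmx0 add0r => ->; rewrite trmx0.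
  move: E2; rewrite y2_0 u0 !mulmx0 !mxE addr0 l00 mul0r add0r => /eqP.
  rewrite eq_sym oppr_eq0 => /eqP a10.
  move: y1; rewrite big_split_ord /= big1 => [|a _]; last first.
    by rewrite col_mxEu y2_0 mxE.
  rewrite big_split_ord /= !big_ord1 !col_mxEd col_mxEu.
  rewrite -/a0 -/a1 l00 a10 !addr0 => /eqP.
  by rewrite eq_sym oner_eq0.
have l0_gt0 : 0 < a0 by rewrite lt_neqAle eq_sym l0n0.
(* The negative factor turns the nonnegative weights into nonpositive multipliers; the dual value
   becomes [s + a1 / a0]. *)
exists (col_mx (- a0^-1 *: y2) (- a0^-1 *: u)).
  rewrite /dual_feasible /= col_mxKu col_mxKd; split; last first.
    by move=> a; rewrite mxE mulNr oppr_le0 mulr_ge0 ?invr_ge0.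
  rewrite -!scalemxAr -scalerDr.
  move: E1; rewrite addrAC => /eqP; rewrite addr_eq0 => /eqP->.
  by rewrite scaleNr scalerN opprK scalerA mulVf // scale1r.
rewrite dual_objE col_mxKu col_mxKd -!scalemxAr [X in X + _]mxE [X in _ + X]mxE.
rewrite -mulrDr E2 mulrNN mulrDr mulKf // lerDl mulr_ge0 //.
by rewrite invr_ge0.
Qed.

(** Paired with the Slater direction, the stationarity equation writes [c . slater] as a sum of
    nonnegative terms, one per inequality multiplier, which bounds each of them. A right inverse of
    [B] recovers the equality multipliers from these. *)
Lemma compact_dual_feasible : compact dual_feasible.
Proof.
have [D BD] := row_freeP freeB.
have lamB lam : dual_feasible lam ->
    dsubmx lam = D^T *m c - (D^T *m A^T) *m usubmx lam.
  move=> [<- _]; rewrite mulmxDr !mulmxA addrAC subrr add0r -trmx_mul BD trmx1.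
  by rewrite mul1mx.
have lamA lam a : dual_feasible lam ->
    `|usubmx lam a 0| <= \sum_b (c^T *m slater) 0 0 / - (A *m slater) b 0.
  move=> Hlam; have [E lam0] := Hlam.
  have Es : (c^T *m slater) 0 0 = \sum_b usubmx lam b 0 * (A *m slater) b 0.
    by rewrite -E slater_dot.
  have t0 b : 0 <= usubmx lam b 0 * (A *m slater) b 0.
    by rewrite mulr_le0 // ltW.
  have cs0 : 0 <= (c^T *m slater) 0 0 by rewrite Es sumr_ge0.
  rewrite (bigD1 a) //=; apply: ler_wpDr.
    by apply: sumr_ge0 => b _; rewrite divr_ge0 // oppr_ge0 ltW.
  rewrite ler_pdivlMr ?oppr_gt0 // ler0_norm // mulrNN Es (bigD1 a) //= lerDl.
  exact: sumr_ge0.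
have [b1 Hb1] := mulmx_bounded (D^T *m A^T)
  (\sum_b (c^T *m slater) 0 0 / - (A *m slater) b 0).
apply: bounded_closed_compact_cV.
  exists (Num.max (\sum_b (c^T *m slater) 0 0 / - (A *m slater) b 0)
          (\sum_k `|(D^T *m c) k 0| + b1)) => lam Hlam k.
  rewrite le_max -[lam]vsubmxK; case: (split_ordP k) => j ->.
    by rewrite col_mxEu lamA.
  rewrite col_mxEd (lamB _ Hlam) !mxE; apply/orP; right.
  apply: le_trans (ler_normB _ _) _; apply: lerD; last first.
    by have := Hb1 (usubmx lam) (fun a => lamA _ a Hlam) j; rewrite mxE.
  by rewrite [leRHS](bigD1 j) //= mxE lerDl sumr_ge0.
have -> : dual_feasible =
    (\bigcap_k [set lam | ((col_mx A B)^T *m lam) k 0 = c k 0]) `&`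
    (\bigcap_a [set lam : 'cV[R]_(nA + nB) | 0 <= - lam (lshift nB a) 0]).
  have E (lam : 'cV[R]_(nA + nB)) :
      (col_mx A B)^T *m lam = A^T *m usubmx lam + B^T *m dsubmx lam.
    by rewrite tr_col_mx -{1}[lam]vsubmxK mul_row_col.
  apply/seteqP; split=> lam [H1 H2]; split.
  - by move=> k _; rewrite /= E H1.
  - by move=> a _ /=; rewrite oppr_ge0; have := H2 a; rewrite mxE.
  - by rewrite -E; apply/colP => k; exact: H1.
  - by move=> a; rewrite mxE -oppr_ge0; exact: H2.
apply: closedI; apply: closed_bigI => k _.
  by apply: closed_fun_eq; exact: mulmx_coord_continuous.
by apply: closed_fun_ge => x; apply: continuousN; exact: coord_continuous.
Qed.

End DualFace.

(** * Parametric value functions *)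

Lemma ray_near (R : realType) n (x d : 'cV[R]_n) (N : set 'cV[R]_n) :
  nbhs x N -> \forall t \near (0 : R)^'+, N (x + t *: d).
Proof.
move=> Nx.
have cvgx : x + t *: d @[t --> (0 : R)^'+] --> x.
  suff : x + t *: d @[t --> (0 : R)^'+] --> x + 0 *: d by rewrite scale0r addr0.
  apply: cvgD; first exact: cvg_cst.
  apply: cvgZr_tmp; apply: cvg_at_right_filter; exact: cvg_id.
exact: cvgx.
Qed.

Section ValueFunction.
Variables (R : realType) (nA nB nx np : nat).
Variables (A : 'M[R]_(nA, nx)) (B : 'M[R]_(nB, nx)).
Variables (GA : 'M[R]_(nA, np)) (GB : 'M[R]_(nB, np)) (i : 'I_nx).
Variables (feas : 'cV[R]_np -> set 'cV[R]_nx) (phat : 'cV[R]_np) (xihat : 'cV[R]_nx).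
Variables (N : set 'cV[R]_np) (lo hi : R) (slater : 'cV[R]_nx).

Hypothesis slaterA : forall a, (A *m slater) a 0 < 0.
Hypothesis slaterB : B *m slater = 0.
Hypothesis freeB : row_free B.
Hypothesis feas_bound : forall p xi, feas p xi -> lo <= xi i 0 <= hi.
Hypothesis feas_hat : feas phat xihat.
Hypothesis optimal_hat : forall xi, feas phat xi -> xihat i 0 <= xi i 0.
Hypothesis nbhsN : nbhs phat N.
Hypothesis feas_neq0 : forall p, N p -> feas p !=set0.
Hypothesis feas_convex : forall p1 p2 xi1 xi2 (t : R), N p1 -> N p2 ->
  feas p1 xi1 -> feas p2 xi2 -> 0 <= t <= 1 ->
  feas ((1 - t) *: p1 + t *: p2) ((1 - t) *: xi1 + t *: xi2).
Hypothesis feas_linearized : forall p xi, N p -> feas p xi ->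
  (forall a, (A *m (xi - xihat)) a 0 <= (GA *m (p - phat)) a 0) /\
  B *m (xi - xihat) = GB *m (p - phat).
Hypothesis feas_ray : forall w d,
  (forall a, (A *m w) a 0 < (GA *m d) a 0) -> B *m w = GB *m d ->
  \forall t \near 0^'+, feas (phat + t *: d) (xihat + t *: w).

Let val p := inf [set xi i 0 | xi in feas p].

Lemma val_le p xi : feas p xi -> val p <= xi i 0.
Proof.
move=> Hxi; apply: ge_inf; last by exists xi.
by exists lo => _ [z /feas_bound/andP[? _] <-].
Qed.

(** [N p] supplies a feasible point; the infimum of an empty set would be a mere default value. *)
Lemma le_val p a : N p -> (forall xi, feas p xi -> a <= xi i 0) -> a <= val p.
Proof.
move=> Np Ha; apply: lb_le_inf; last by move=> _ [xi /Ha ? <-].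
by have [xi Hxi] := feas_neq0 Np; exists (xi i 0), xi.
Qed.

Lemma val_hat : val phat = xihat i 0.
Proof.
apply/le_anti; rewrite val_le //=; apply: le_val optimal_hat.
exact: nbhs_singleton.
Qed.

Let Lam := dual_feasible A B (delta_mx i 0).
Let obj := dual_obj GA GB.

Lemma delta_dot (w : 'cV[R]_nx) : ((delta_mx i 0 : 'cV[R]_nx)^T *m w) 0 0 = w i 0.
Proof. by rewrite trmx_delta -rowE mxE. Qed.

(** The alternative with [d = 0] and [s = 0]: its second case is a feasible ray at [phat] along
    which coordinate [i] decreases, contradicting the optimality of [xihat]. *)
Lemma dual_feasible_neq0 : Lam !=set0.
Proof.
have [[lam ? _]|[w [Aw Bw]]] :=
  lp_alternative GA GB (delta_mx i 0) slaterA slaterB freeB 0 0; first by exists lam.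
rewrite delta_dot => wi.
have /filter_ex[t [t0]] : \forall t \near 0^'+,
    0 < t /\ feas (phat + t *: 0) (xihat + t *: w).
  by near=> t; split; near: t; [exact: nbhs_right_gt|exact: feas_ray].
rewrite scaler0 addr0 => /optimal_hat.
by rewrite !mxE lerDl pmulr_rge0 // leNgt wi.
Unshelve. all: by end_near. Qed.

Lemma val_dquot d s : is_maximum Lam (obj d) s -> dquot val phat d t @[t --> 0^'+] --> s.
Proof.
move=> [[lam [Hlam <-]] objmax].
suff bnd e : 0 < e -> \forall t \near 0^'+,
    obj d lam <= dquot val phat d t <= obj d lam + e.
  apply/cvgrPdist_le => e e0; near=> t.
  have /andP[lb ub] : obj d lam <= dquot val phat d t <= obj d lam + e.
    by near: t; exact: bnd.
  by rewrite ler0_norm ?subr_le0 // opprB lerBlDl.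
move=> e0.
(* No multiplier reaches [obj d lam + e], so the alternative yields a direction [w] with slope below
   that level. *)
have [[l Hl]|[w [Aw Bw]]] :=
  lp_alternative GA GB (delta_mx i 0) slaterA slaterB freeB d (obj d lam + e).
  by move=> /le_trans/(_ (objmax _ Hl)); rewrite gerDl leNgt e0.
rewrite delta_dot => wi; near=> t.
have t0 : 0 < t by near: t; exact: nbhs_right_gt.
rewrite /dquot val_hat; apply/andP; split.
  rewrite ler_pdivlMr // lerBrDl.
  have Nt : N (phat + t *: d) by near: t; exact: ray_near.
  (* Lower bound: the displacement of any feasible point satisfies the linearized constraints for
     [t *: d], so weak duality applies to it. *)
  apply: le_val => // xi /(feas_linearized Nt) [HA HB].
  have := weak_duality Hlam HA HB.
  rewrite delta_dot addrAC subrr -/obj => /le_trans; rewrite -lerBrDl.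
  have -> : obj (0 + t *: d) lam = obj d lam * t.
    by rewrite /obj dual_objDZ /dual_obj mulmx0 trmx0 mul0mx mxE add0r mulrC.
  by apply; rewrite !mxE.
rewrite ler_pdivrMr // lerBlDl.
have /val_le : feas (phat + t *: d) (xihat + t *: w).
  by near: t; exact: feas_ray.
move=> /le_trans; apply; rewrite !mxE lerD2l mulrC ler_wpM2r ?ltW //.
Unshelve. all: by end_near. Qed.

(* A point [z] near [y] is a convex combination of [y] and the point [z'] obtained by
   prolonging the segment [y, z] by the length [r]; there [val] is bounded. *)
Lemma val_loc_lipschitz : loc_lipschitz val phat.
Proof.
have /nbhs_normP[e /= e0 eN] := nbhsN.
pose r := e / 2; have r0 : 0 < r by rewrite divr_gt0.
have rN p : `|phat - p| < r + r -> N p by move=> pr; apply: eN; rewrite /= [e]splitr.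
exists [set p | `|phat - p| < r]; split.
  apply/(@nbhs_normP R 'cV[R]_np phat (fun p => `|phat - p| < r)); exists r => //. 
exists ((hi - lo) / r).
suff side y z : `|phat - y| < r -> `|phat - z| < r ->
    val z - val y <= (hi - lo) / r * `|z - y|.
  move=> y z /= Uy Uz; rewrite ler_norml side // andbT lerNl opprB distrC.
  exact: side.
move=> Uy Uz; have [->|yz] := eqVneq z y; first by rewrite !subrr normr0 mulr0.
pose dl := `|z - y|; have dl0 : 0 < dl by rewrite normr_gt0 subr_eq0.
(* [z'] lies at distance [r] beyond [z], within [2 r = e] of [phat]; the segment from [y] to [z']
   has length [r + dl], whence the weight [t]. *)
pose z' := z + (r / dl) *: (z - y); pose t := dl / (r + dl).
have rd0 : 0 < r + dl by rewrite addr_gt0.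
have Nz' : N z'.
  apply: rN; rewrite opprD addrA; apply: le_lt_trans (ler_normB _ _) _.
  rewrite normrZ ger0_norm ?divr_ge0 ?ltW // divfK ?gt_eqF //.
  by rewrite ltrD2r.
have Ny : N y by apply: rN; rewrite (lt_trans Uy) // ltrDl.
have t01 : 0 <= t <= 1.
  apply/andP; split; first by rewrite divr_ge0 // ltW.
  by rewrite ler_pdivrMr // mul1r lerDr ltW.
have zE : z = (1 - t) *: y + t *: z'.
  apply/colP => k; rewrite /z' /t !mxE.
  by field; rewrite !gt_eqF.
have hl : lo <= hi.
  by have /andP[] := feas_bound feas_hat; exact: le_trans.
have tr : t <= dl / r.
  rewrite /t ler_pM2l // lef_pV2 ?posrE // lerDl; exact: ltW.
rewrite lerBlDr -lerBlDl; apply: le_val => // xi Hxi.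
(* Any point feasible at [y], combined with one feasible at [z'], is feasible at [z]. *)
have [xi' Hxi'] := feas_neq0 Nz'.
have := val_le (feas_convex Ny Nz' Hxi Hxi' t01); rewrite -zE => zle.
rewrite lerBlDl; apply: le_trans zle _; rewrite !mxE.
have /andP[lo1 hi1] := feas_bound Hxi; have /andP[lo2 hi2] := feas_bound Hxi'.
have h1 : t * (xi' i 0 - xi i 0) <= t * (hi - lo).
  by rewrite ler_wpM2l ?(andP t01).1 // lerB.
have h2 : t * (hi - lo) <= dl / r * (hi - lo) by rewrite ler_wpM2r ?subr_ge0.
have -> : (hi - lo) / r * `|z - y| = dl / r * (hi - lo) by rewrite /dl; ring.
by move: (le_trans h1 h2); lra.
Qed.

End ValueFunction.

(** * Gradients of jointly convex functions *)

Section DotProduct.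
Variables (R : realType) (n : nat).
Implicit Types u v : 'cV[R]_n.

Lemma dotvDr u v v' : dotv u (v + v') = dotv u v + dotv u v'.
Proof. by rewrite /dotv -big_split; apply: eq_bigr => k _; rewrite mxE mulrDr. Qed.

Lemma dotvZr u (t : R) v : dotv u (t *: v) = t * dotv u v.
Proof. by rewrite /dotv mulr_sumr; apply: eq_bigr => k _; rewrite mxE mulrCA. Qed.

Lemma dotv0r u : dotv u 0 = 0.
Proof. by rewrite /dotv big1 // => k _; rewrite mxE mulr0. Qed.

Lemma dotv0l u : dotv 0 u = 0.
Proof. by rewrite /dotv big1 // => k _; rewrite mxE mul0r. Qed.

Lemma dotvNr u v : dotv u (- v) = - dotv u v.
Proof. by rewrite /dotv -sumrN; apply: eq_bigr => k _; rewrite mxE mulrN. Qed.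

End DotProduct.

Section Gradients.
Variables (R : realType) (nx np : nat).
Implicit Types (F : 'cV[R]_nx -> 'cV[R]_np -> R) (z w : 'cV[R]_nx) (p d : 'cV[R]_np).

Lemma jointE F z p : joint F (col_mx z p) = F z p.
Proof. by rewrite /joint col_mxKu col_mxKd. Qed.

Lemma joint_ray F z p w d t :
  joint F (t *: col_mx w d + col_mx z p) = F (t *: w + z) (t *: d + p).
Proof. by rewrite scale_col_mx add_col_mx jointE. Qed.

(** A partial derivative and the joint derivative along the embedded direction are limits of the
    same quotient. *)
Lemma gradxE F z p k : differentiable (joint F) (col_mx z p) ->
  gradx F z p k 0 = 'd (joint F) (col_mx z p) (col_mx (delta_mx k 0) 0).
Proof.
move=> dF; rewrite -deriveE // mxE /derive.
apply: (congr1 (fun f : R -> R => lim (f t @[t --> 0^'])));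
  apply/funext => t /=.
by rewrite /shift /= joint_ray jointE scaler0 add0r.
Qed.

Lemma gradyE F z p k : differentiable (joint F) (col_mx z p) ->
  grady F z p k 0 = 'd (joint F) (col_mx z p) (col_mx 0 (delta_mx k 0)).
Proof.
move=> dF; rewrite -deriveE // mxE /derive.
apply: (congr1 (fun f : R -> R => lim (f t @[t --> 0^'])));
  apply/funext => t /=.
by rewrite /shift /= joint_ray jointE scaler0 add0r.
Qed.

Lemma diff_jointE F z p w d : differentiable (joint F) (col_mx z p) ->
  'd (joint F) (col_mx z p) (col_mx w d) = dotv (gradx F z p) w + dotv (grady F z p) d.
Proof.
move=> dF; set D := 'd _ _.
have -> : col_mx w d = \sum_k w k 0 *: col_mx (delta_mx k 0) 0
                     + \sum_k d k 0 *: col_mx 0 (delta_mx k 0).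
  have sum_col m q (I : finType) (f : I -> 'cV[R]_m) (g : I -> 'cV[R]_q) :
      \sum_k col_mx (f k) (g k) = col_mx (\sum_k f k) (\sum_k g k).
    elim/big_rec3: _ => [|k a b c _ ->]; first by rewrite col_mx0.
    by rewrite add_col_mx.
  under eq_bigr do rewrite scale_col_mx scaler0.
  under [X in _ + X]eq_bigr do rewrite scale_col_mx scaler0.
  rewrite !sum_col !big1_eq add_col_mx addr0 add0r.
  by congr col_mx; rewrite [LHS]matrix_sum_delta; apply: eq_bigr => k _;
    rewrite big_ord1.
rewrite linearD !linear_sum /dotv; congr (_ + _); apply: eq_bigr => k _.
  by rewrite linearZ /= gradxE // mulrC.
by rewrite linearZ /= gradyE // mulrC.
Qed.

Lemma ray_derivative F z p w d : differentiable (joint F) (col_mx z p) ->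
  (F (z + t *: w) (p + t *: d) - F z p) / t @[t --> 0^'+] -->
  dotv (gradx F z p) w + dotv (grady F z p) d.
Proof.
move=> dF; rewrite -diff_jointE // -deriveE //.
have /= dv := diff_derivable (v := col_mx w d) dF.
apply: cvg_dnbhs_at_right.
rewrite (_ : (fun t : R => _) = (fun t => t^-1 *:
   ((joint F \o shift (col_mx z p)) (t *: col_mx w d) - joint F (col_mx z p)))) //.
apply/funext => t /=; rewrite /shift /= joint_ray jointE mulrC.
by rewrite ![_ + t *: _]addrC.
Qed.

(** Along the ray, [F] is its base value plus [t] times a convergent difference quotient. *)
Lemma ray_continuous F z p w d : differentiable (joint F) (col_mx z p) ->
  F (z + t *: w) (p + t *: d) @[t --> 0^'+] --> F z p.
Proof.
move=> dF; have t0 : t @[t --> (0 : R)^'+] --> (0 : R).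
  by apply: cvg_at_right_filter; exact: cvg_id.
have Flim : F z p + t * ((F (z + t *: w) (p + t *: d) - F z p) / t)
    @[t --> 0^'+] --> F z p.
  rewrite -[X in _ --> X]addr0 -[X in _ + X](mul0r (dotv (gradx F z p) w + dotv (grady F z p) d)).
  by apply: cvgD; [exact: cvg_cst|apply: cvgM => //; exact: ray_derivative].
refine (cvg_trans _ Flim); apply: near_eq_cvg; near=> t.
have t_gt0 : 0 < t by near: t; exact: nbhs_right_gt.
by rewrite /= mulrC divfK ?gt_eqF // subrKC.
Unshelve. all: by end_near. Qed.

(** Convexity bounds each difference quotient on the segment by the full increment; let [t] tend to
    0. *)
Lemma convex_gradient_le (S : set ('cV[R]_nx * 'cV[R]_np)) F z p z' p' :
  convex_on S F -> differentiable (joint F) (col_mx z p) -> S (z, p) -> S (z', p') ->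
  dotv (gradx F z p) (z' - z) + dotv (grady F z p) (p' - p) <= F z' p' - F z p.
Proof.
move=> cF dF Sz Sz'.
apply: ler_cvg_to (ray_derivative (w := z' - z) (d := p' - p) dF) (cvg_cst (F z' p' - F z p)) _.
near=> t.
have t0 : 0 < t by near: t; exact: nbhs_right_gt.
have t1 : t <= 1 by near: t; exact: nbhs_right_le.
have seg m (a b : 'cV[R]_m) : a + t *: (b - a) = (1 - t) *: a + t *: b.
  by apply/colP => k; rewrite !mxE; ring.
rewrite ler_pdivrMr // !seg.
have := cF _ _ _ _ t Sz Sz'; rewrite (ltW t0) t1 => /(_ isT).
by rewrite mulrBl; lra.
Unshelve. all: by end_near. Qed.

Lemma affine_differentiable F (w : 'cV[R]_(nx + np)) : is_affine F -> differentiable (joint F) w.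
Proof.
move=> [a [b [c FE]]].
have -> : joint F = (\sum_k (col_mx a b k 0) *: (fun w : 'cV[R]_(nx + np) => w k 0)) + cst c.
  apply/funext => u; rewrite /joint FE /= fctE; congr (_ + _).
  rewrite fct_sumE big_split_ord /=; congr (_ + _); apply: eq_bigr => k _;
    by rewrite fctE ?col_mxEu ?col_mxEd mxE.
apply: differentiableD; last exact: differentiable_cst.
apply: differentiable_sum => k; apply: differentiableZ.
exact: differentiable_coord.
Qed.

Lemma affine_convex (S : set ('cV[R]_nx * 'cV[R]_np)) F : is_affine F -> convex_on S F.
Proof.
move=> [a [b [c FE]]] z1 p1 z2 p2 t _ _ _.
by rewrite !FE !dotvDr !dotvZr le_eqVlt; apply/orP; left; apply/eqP; ring.
Qed.

(** For an affine function the difference quotients are constantly equal to the increment. *)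
Lemma affine_increment F z p z' p' : is_affine F ->
  F z' p' - F z p = dotv (gradx F z p) (z' - z) + dotv (grady F z p) (p' - p).
Proof.
move=> aF; have dF := affine_differentiable (col_mx z p) aF.
have H := ray_derivative (w := z' - z) (d := p' - p) dF.
rewrite -(cvg_lim (@Rhausdorff R) H); apply/esym/cvg_lim; first exact: Rhausdorff.
case: aF => [a [b [c FE]]].
apply: cvg_near_cst; near=> t.
have t0 : 0 < t by near: t; exact: nbhs_right_gt.
rewrite !FE !dotvDr !dotvZr !dotvDr !dotvNr.
by field; rewrite gt_eqF.
Unshelve. all: by end_near. Qed.

End Gradients.

(** * Families of smooth constraints and their gradient matrices *)

Lemma fam_max_le0 (R : realType) m (F : 'I_m.+1 -> R) :
  fam_max F <= 0 <-> forall l, F l <= 0.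
Proof.
split=> [/bigmax_leP[_ F0] l|F0]; first exact: F0.
by apply/bigmax_leP; split.
Qed.

Lemma fam_min_ge0 (R : realType) m (F : 'I_m.+1 -> R) :
  0 <= fam_min F <-> forall l, 0 <= F l.
Proof.
split=> [/bigmin_geP[_ F0] l|F0]; first exact: F0.
by apply/bigmin_geP; split.
Qed.

Section GradientRows.
Variables (R : realType) (nx np m : nat) (f : 'I_m -> 'cV[R]_nx -> 'cV[R]_np -> R).
Variables (z : 'cV[R]_nx) (p : 'cV[R]_np).

Lemma gradx_mulmx w a :
  ((\matrix_(a < m, k < nx) gradx (f a) z p k 0) *m w) a 0 = dotv (gradx (f a) z p) w.
Proof. by rewrite mxE /dotv; apply: eq_bigr => k _; rewrite mxE. Qed.

Lemma grady_mulmx d a :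
  ((\matrix_(a < m, k < np) - grady (f a) z p k 0) *m d) a 0 = - dotv (grady (f a) z p) d.
Proof. by rewrite mxE /dotv -sumrN; apply: eq_bigr => k _; rewrite mxE mulNr. Qed.

End GradientRows.

Lemma nth_cols (R : realType) n r (M : 'M[R]_(n, r)) (q : 'I_r) :
  nth 0 (cols M) q = col q M.
Proof. by rewrite (nth_map q) ?size_enum_ord // nth_ord_enum. Qed.

(** * Lexicographic derivatives of the relaxation of the implicit function *)

Unset Implicit Arguments.
Set Strict Implicit.

Theorem theorem5p4 (R : realType) (nx np nf nh : nat)
  (Hdim : (nf + nh)%N = nx)
  (ftil : 'I_nf -> 'cV[R]_nx -> 'cV[R]_np -> R)
  (h : 'I_nh -> 'cV[R]_nx -> 'cV[R]_np -> R)
  (ncv ncc : 'I_nf -> nat)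
  (phi : forall k, 'I_(ncv k).+1 -> 'cV[R]_nx -> 'cV[R]_np -> R)
  (psi : forall k, 'I_(ncc k).+1 -> 'cV[R]_nx -> 'cV[R]_np -> R)
  (P : set 'cV[R]_np) (xL xU : 'cV[R]_nx) (i : 'I_nx)
  (phat : 'cV[R]_np) (xihat : 'cV[R]_nx) :
  let X := box xL xU in
  let XP := [set zp | X zp.1 /\ P zp.2] in
  (* relaxations of ftil: pointwise max / min of the smooth pieces *)
  let fcv k z p := fam_max (fun l => phi k l z p) in
  let fcc k z p := fam_min (fun l => psi k l z p) in
  let Q := [set p | P p /\ exists z, (forall k, ftil k z p = 0) /\ (forall j, h j z p = 0)] in
  (* x_i^cv; the relaxations of the affine h are h itself *)
  let xcv : 'cV[R]_np -> R := fun p =>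
    inf [set xi i 0 | xi in [set xi | X xi /\
           (forall k, fcv k xi p <= 0 <= fcc k xi p) /\
           (forall j, h j xi p <= 0 <= h j xi p)]] in
  let g := gfun phi psi xL xU in
  let gfeas p xi := (forall j, h j xi p = 0) /\ (forall c, g c xi p <= 0) in
  convex_set P -> compact P -> Q !=set0 ->
  (exists xf : 'cV[R]_np -> 'cV[R]_nx, forall p, Q p ->
      (forall k, ftil k (xf p) p = 0) /\ (forall j, h j (xf p) p = 0) /\ X (xf p)) ->
  (forall j, is_affine (h j)) ->
  (forall k, ~ is_affine (ftil k)) ->
  (forall k l, C1 (phi k l) /\ convex_on XP (phi k l)) ->
  (forall k l, C1 (psi k l) /\ concave_on XP (psi k l)) ->
  (forall k z p, XP (z, p) -> fcv k z p <= ftil k z p <= fcc k z p) ->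
  interior Q phat ->
  row_free (\matrix_(j < nh, k < nx) gradx (h j) xihat phat k 0) ->
  (exists N, nbhs phat N /\ N `<=` Q /\
     forall p, N p -> exists xi, X xi /\ (forall j, h j xi p = 0) /\ (forall c, g c xi p < 0)) ->
  gfeas phat xihat -> (forall xi, gfeas phat xi -> xihat i 0 <= xi i 0) ->
  let act := [pred c | g c xihat phat == 0] in
  let nA := #|act| in
  let A : 'M[R]_(nA, nx) := \matrix_(a < nA, k < nx) gradx (g (enum_val a)) xihat phat k 0 in
  let GA : 'M[R]_(nA, np) := \matrix_(a < nA, k < np) - grady (g (enum_val a)) xihat phat k 0 in
  let B : 'M[R]_(nh, nx) := \matrix_(j < nh, k < nx) gradx (h j) xihat phat k 0 in
  let GB : 'M[R]_(nh, np) := \matrix_(j < nh, k < np) - grady (h j) xihat phat k 0 in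
  let G : 'M[R]_(nA + nh, np) := col_mx GA GB in
  Lsmooth xcv phat /\
  forall r (M : 'M[R]_(np, r)),
    let F := lexfun xcv phat (cols M) in
    let mcol (j : nat) := nth 0 (cols M) j in
    let obj (d : 'cV[R]_np) (lam : 'cV[R]_(nA + nh)) := ((G *m d)^T *m lam) 0 0 in
    let Lam (j : nat) : set 'cV[R]_(nA + nh) :=
      [set lam | A^T *m usubmx lam + B^T *m dsubmx lam = delta_mx i 0 /\
                 (forall a, usubmx lam a 0 <= 0) /\
                 (forall q : 'I_r, (q < j)%N -> - obj (col q M) lam <= - F q (col q M))] in
    let D (j : nat) := argmax_set (Lam j) (obj (mcol j)) in
    (forall j, (j <= r)%N -> forall d, is_maximum (Lam j) (obj d) (F j d)) /\
    (forall j, (0 < j < r)%N ->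
       D j = argmax_set (D j.-1) (obj (mcol j)) /\ D j `<=` D j.-1) /\
    ((0 < r)%N -> forall lam, D r.-1 lam -> LDder xcv phat M = lam^T *m G *m M).
Proof.
move=> X XP fcv fcc Q xcv g gfeas _ _ _ _ aff_h _ Hphi Hpsi _ _ freeB [N [nbhsN [NQ Hslater]]].
move=> feas_hat opt_hat act nA A GA B GB G.
have NP p : N p -> P p by move=> /NQ[].
have Phat : P phat by apply: NP; exact: nbhs_singleton.
have affine_box j (s c : R) : is_affine (fun (z : 'cV[R]_nx) (p : 'cV[R]_np) => s * z j 0 + c).
  exists (s *: delta_mx j 0), 0, c => z p.
  rewrite dotv0l addr0 /dotv (bigD1 j) //= !mxE !eqxx mulr1 big1 ?addr0 // => l lj.
  by rewrite !mxE (negbTE lj) mulr0 mul0r.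
(* The concave pieces enter [g] negated, and the box constraints are affine. *)
have g_spec c : (forall w, differentiable (joint (g c)) w) /\ convex_on XP (g c).
  case: c => [[[k l]|[k l]]|[j|j]].
  - by have [[? _] ?] := Hphi k l.
  - have [[dpsi _] cpsi] := Hpsi k l; split=> // w.
    exact: differentiableN (dpsi w).
  - have aff : is_affine (g (inr (inl j))).
      have [a [b [c E]]] := affine_box j 1 (- xU j 0).
      by exists a, b, c => z p; rewrite -E mul1r.
    by split=> [w|]; [exact: affine_differentiable|exact: affine_convex].
  - have aff : is_affine (g (inr (inr j))).
      have [a [b [c E]]] := affine_box j (-1) (xL j 0).
      by exists a, b, c => z p; rewrite -E mulN1r addrC.
    by split=> [w|]; [exact: affine_differentiable|exact: affine_convex].
have gX p xi : gfeas p xi -> X xi.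
  move=> [_ gxi] k; have := gxi (inr (inl k)); have := gxi (inr (inr k)).
  by rewrite /= !subr_le0 => -> ->.
(* The paired inequalities on [h] amount to equality, the max and min split into their pieces, and
   the box conditions are the last two families of [g]. *)
have feasE p : [set xi | X xi /\ (forall k, fcv k xi p <= 0 <= fcc k xi p) /\
           (forall j, h j xi p <= 0 <= h j xi p)] = gfeas p.
  apply/seteqP; split=> xi /=.
    move=> [Xxi [rel hxi]]; split=> [j|[[[k l]|[k l]]|[k|k]]] /=.
    - by apply/le_anti; exact: hxi.
    - by have /andP[/fam_max_le0 + _] := rel k; exact.
    - by have /andP[_ /fam_min_ge0 +] := rel k; rewrite oppr_le0; exact.
    - by rewrite subr_le0; have /andP[] := Xxi k.
    - by rewrite subr_le0; have /andP[] := Xxi k.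
  move=> Hxi; have [hxi gxi] := Hxi; split; first exact: gX Hxi.
  split=> [k|j]; last by rewrite hxi lexx.
  apply/andP; split; first by apply/fam_max_le0 => l; exact: (gxi (inl (inl (existT _ k l)))).
  apply/fam_min_ge0 => l; rewrite -oppr_le0.
  exact: (gxi (inl (inr (existT _ k l)))).
have xcvE : xcv = (fun p => inf [set xi i 0 | xi in gfeas p]).
  by apply/funext => p; rewrite /xcv feasE.
have XPhat : XP (xihat, phat) by split=> //; exact: gX feas_hat.
have active (a : 'I_nA) : g (enum_val a) xihat phat = 0.
  by apply/eqP; exact: (enum_valP a).
have rowA w (a : 'I_nA) : (A *m w) a 0 = dotv (gradx (g (enum_val a)) xihat phat) w.
  exact: (gradx_mulmx (fun a : 'I_nA => g (enum_val a))).
have rowGA d (a : 'I_nA) : (GA *m d) a 0 = - dotv (grady (g (enum_val a)) xihat phat) d.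
  exact: (grady_mulmx (fun a : 'I_nA => g (enum_val a))).
have lin_h p xi : (forall j, h j xi p = 0) -> B *m (xi - xihat) = GB *m (p - phat).
  move=> hxi; apply/colP => j; rewrite gradx_mulmx grady_mulmx.
  have := affine_increment xihat phat xi p (aff_h j).
  by rewrite hxi feas_hat.1 subrr; lra.
have lin_g p xi (a : 'I_nA) : P p -> X xi -> dotv (gradx (g (enum_val a)) xihat phat) (xi - xihat)
    + dotv (grady (g (enum_val a)) xihat phat) (p - phat) <= g (enum_val a) xi p.
  move=> Pp Xxi; have [dg cg] := g_spec (enum_val a).
  by have := convex_gradient_le cg (dg _) XPhat (conj Xxi Pp); rewrite active subr0.
have [xis [Xxis [hxis gxis]]] := Hslater _ (nbhs_singleton nbhsN).
(* By the gradient inequality each active linearized constraint at this displacement lies below [g]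
   at the Slater point, hence is strictly negative. *)
pose slater := xis - xihat.
have slaterA a : (A *m slater) a 0 < 0.
  rewrite rowA; apply: le_lt_trans (gxis (enum_val a)).
  by have := lin_g phat xis a Phat Xxis; rewrite subrr dotv0r addr0.
have slaterB : B *m slater = 0 by rewrite (lin_h phat) // subrr mulmx0.
have feas_bound p xi : gfeas p xi -> xL i 0 <= xi i 0 <= xU i 0 by move=> /gX.
have feas_neq0 p : N p -> gfeas p !=set0.
  move=> /Hslater[xi [_ [hxi gxi]]]; exists xi; split=> // c; exact: ltW.
have feas_convex p1 p2 xi1 xi2 (t : R) : N p1 -> N p2 ->
    gfeas p1 xi1 -> gfeas p2 xi2 -> 0 <= t <= 1 ->
    gfeas ((1 - t) *: p1 + t *: p2) ((1 - t) *: xi1 + t *: xi2).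
  move=> /NP P1 /NP P2 f1 f2 t01; split=> [j|c].
    have [a [b [c hE]]] := aff_h j.
    transitivity ((1 - t) * h j xi1 p1 + t * h j xi2 p2).
      by rewrite !hE !dotvDr !dotvZr; ring.
    by rewrite f1.1 f2.1 !mulr0 addr0.
  have := (g_spec c).2 _ _ _ _ t (conj (gX _ _ f1) P1) (conj (gX _ _ f2) P2) t01.
  move=> /le_trans; apply; have /andP[t0 t1] := t01.
  by rewrite -[leRHS](addr0 0) lerD // mulr_ge0_le0 ?subr_ge0 ?f1.2 ?f2.2.
have feas_lin p xi : N p -> gfeas p xi ->
    (forall a, (A *m (xi - xihat)) a 0 <= (GA *m (p - phat)) a 0) /\
    B *m (xi - xihat) = GB *m (p - phat).
  move=> /NP Pp Hxi; split=> [a|]; last by apply: lin_h; exact: Hxi.1.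
  rewrite rowA rowGA -subr_le0 opprK.
  exact: le_trans (lin_g p xi a Pp (gX _ _ Hxi)) (Hxi.2 _).
have feas_ray w d : (forall a, (A *m w) a 0 < (GA *m d) a 0) -> B *m w = GB *m d ->
    \forall t \near 0^'+, gfeas (phat + t *: d) (xihat + t *: w).
  move=> Aw Bw.
  have ray_h t j : h j (xihat + t *: w) (phat + t *: d) = 0.
    have := affine_increment xihat phat (xihat + t *: w) (phat + t *: d) (aff_h j).
    rewrite feas_hat.1 subr0 ![_ + t *: _]addrC !addrK !dotvZr => ->.
    rewrite -(gradx_mulmx h) -/B Bw grady_mulmx mulrN addNr //.
  (* An inactive constraint stays negative by continuity; an active one starts at 0 with negative
     slope. *)
  have ray_g c : \forall t \near 0^'+, g c (xihat + t *: w) (phat + t *: d) <= 0.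
    have [dg _] := g_spec c.
    have [gc|gc] := eqVneq (g c xihat phat) 0; last first.
      have /cvgr_le Hle := ray_continuous w d (dg (col_mx xihat phat)); apply: Hle.
      by rewrite lt_neqAle gc feas_hat.2.
    have cact : c \in act by rewrite inE; apply/eqP.
    have := Aw (enum_rank_in cact c); rewrite rowA rowGA enum_rankK_in // -subr_lt0 opprK.
    have /cvgr_lt Hlt := ray_derivative (w := w) (d := d) (dg (col_mx xihat phat)).
    move=> /Hlt Hnear.
    near=> t; have t0 : 0 < t by near: t; exact: nbhs_right_gt.
    have : (g c (xihat + t *: w) (phat + t *: d) - g c xihat phat) / t < 0.
      by near: t.
    by rewrite gc subr0 pmulr_llt0 ?invr_gt0 // => /ltW.
  near=> t; split=> [j|]; first exact: ray_h.
  (* There are finitely many constraints, so one range of [t] serves them all. *)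
  by near: t; apply: filter_forall => c; exact: ray_g.
have compL : compact (dual_feasible A B (delta_mx i 0)).
  exact: compact_dual_feasible slaterA slaterB freeB.
have L_neq0 := dual_feasible_neq0 slaterA slaterB freeB opt_hat feas_ray.
have obj_cont d : continuous (dual_obj GA GB d) by exact: dual_obj_continuous.
have objDZ := @dual_objDZ R nA nh np GA GB.
have dquotL d v (maxv : is_maximum (dual_feasible A B (delta_mx i 0)) (dual_obj GA GB d) v) :
    dquot xcv phat d t @[t --> 0^'+] --> v.
  rewrite xcvE; exact: (val_dquot slaterA slaterB freeB feas_bound feas_hat opt_hat
    nbhsN feas_neq0 feas_lin feas_ray maxv).
split.
  split.
    rewrite xcvE; exact: (val_loc_lipschitz feas_bound feas_hat nbhsN feas_neq0 feas_convex).
  move=> r M; exact: (lexface_wd _ compL L_neq0 obj_cont objDZ dquotL).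
move=> r M F mcol obj Lam D.
pose face := lexface (dual_feasible A B (delta_mx i 0)) (dual_obj GA GB) xcv phat (cols M).
(* Up to signs and the passage from ordinals to naturals below [j], the LP constraints are those of
   [lexface]. *)
have LamE j : (j <= r)%N -> Lam j = face j.
  move=> jr; apply/seteqP; split=> lam /=.
    move=> [lamE [lam0 Hq]]; split=> // q qj.
    pose q' := Ordinal (leq_trans qj jr).
    by have := Hq q' qj; rewrite lerN2 -nth_cols.
  move=> [[lamE lam0] Hq]; do 2!split=> //; move=> q qj.
  by rewrite lerN2 -nth_cols; exact: Hq.
have face_max j := lexface_maximum (cols M) compL L_neq0 obj_cont objDZ dquotL j.
(* Index shift: [mcol j] is the column numbered [j + 1] from one, and its maximizers over stage [j]
   form the next face. *)
have DE j : (j <= r)%N -> D j = face j.+1.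
  move=> jr; rewrite /D LamE //.
  exact: (argmax_lexface (cols M) compL L_neq0 obj_cont objDZ dquotL).
split; first by move=> j jr d; rewrite LamE //; exact: (face_max j).2.
split.
  case=> // j /= jr.
  have jr' := ltnW jr.
  split; first by rewrite {1}/D LamE // -DE // ltnW.
  rewrite !DE // ?(ltnW jr') // => lam.
  by rewrite /face lexfaceS => -[].
(* Here [lam] lies in face [r], where all [r] constraints are tight; the tight values are the
   entries of the LD-derivative. *)
move=> r0 lam; rewrite DE ?leq_pred // prednK // => Hlam.
apply/rowP => q; rewrite mxE.
have -> : (lam^T *m G *m M) 0 q = (lam^T *m G *m col q M) 0 0.
  by rewrite colE mulmxA -colE [RHS]mxE.
have := lexface_obj compL L_neq0 obj_cont objDZ dquotL (ltn_ord q) Hlam.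
by rewrite nth_cols => <-; rewrite /dual_obj tr_mulmxC mulmxA.
Unshelve. all: by end_near. Qed.
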